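(* Let $m$ and $e$ be integers such that $m\geq e\geq 2$. Then: (1) $g(m,e)=\min\{g(S)\mid S\in\mathcal{C}(m,e)\}$; (2) $\{S\in\mathcal{L}(m,e)\mid g(S)=g(m,e)\}=\{S\in\mathcal{C}(m,e)\mid g(S)=g(m,e)\}$.
   Context: $\mathbb{N}$ denotes the set of non-negative integers. A numerical semigroup is a subset $S\subseteq\mathbb{N}$ closed under addition, with $0\in S$ and $\mathbb{N}\setminus S$ finite. $msg(S)$ is the (unique, finite) minimal system of generators of $S$ and the embedding dimension $e(S)$ is its cardinality. The multiplicity $m(S)$ is the least positive integer belonging to $S$; the genus $g(S)$ is the cardinality of $\mathbb{N}\setminus S$. $\mathcal{L}(m,e)$ is the set of all numerical semigroups $S$ with $m(S)=m$ and $e(S)=e$, and $g(m,e)=\min\{g(S)\mid S\in\mathcal{L}(m,e)\}$. A numerical semigroup $S$ is packed if $msg(S)\subseteq\{m(S),m(S)+1,\ldots,2m(S)-1\}$; $\mathcal{C}(m,e)$ is the set of all packed numerical semigroups with multiplicity $m$ and embedding dimension $e$. *)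

(* Defs.v *)
From mathcomp Require Import all_boot all_order finmap.
From mathcomp Require Import boolp classical_sets functions cardinality.

Set Implicit Arguments.
Unset Strict Implicit.
Unset Printing Implicit Defensive.

Local Open Scope classical_set_scope.

Definition is_min (A : set nat) (n : nat) : Prop :=
  A n /\ forall k, A k -> n <= k.

(* Equal to 0 when A is empty. *)
Definition min_of (A : set nat) : nat := xget 0 (is_min A).

Lemma min_ofP (A : set nat) : A !=set0 -> is_min A (min_of A).
Proof.
move=> [n An]; apply: xgetPex.
have exA : exists n, `[< A n >] by exists n; apply/asboolP.
case: (ex_minnP exA) => k /asboolP Ak kmin; exists k; split=> // j Aj.
by apply: kmin; apply/asboolP.
Qed.

Lemma is_min_inj (A : set nat) (m n : nat) : is_min A m -> is_min A n -> m = n.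
Proof.
by move=> [Am mA] [An nA]; apply/eqP; rewrite eqn_leq mA// nA.
Qed.

Definition card_of (A : set nat) : nat := #|` fset_set A|.

Definition submonoid (S : set nat) : Prop :=
  S 0 /\ forall x y, S x -> S y -> S (x + y).

Definition generated (A : set nat) : set nat := smallest submonoid A.

Definition numerical_semigroup (S : set nat) : Prop :=
  submonoid S /\ finite_set (~` S).

Definition minimal_generators (S A : set nat) : Prop :=
  generated A = S /\ forall B, B `<` A -> generated B <> S.

(* Any submonoid of nat has exactly one minimal system of generators, finite
   for a numerical semigroup: see minimal_generators_msg, msg_unique and
   finite_msg. *)
Definition msg (S : set nat) : set nat := xget set0 (minimal_generators S).

Definition embedding_dim (S : set nat) : nat := card_of (msg S).

Definition multiplicity (S : set nat) : nat := min_of [set n | S n /\ 0 < n].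

Definition genus (S : set nat) : nat := card_of (~` S).

Definition packed (S : set nat) : Prop :=
  msg S `<=` [set n | multiplicity S <= n <= 2 * multiplicity S - 1].

Definition semigroups (m e : nat) : set (set nat) :=
  [set S | [/\ numerical_semigroup S, multiplicity S = m & embedding_dim S = e]].

Definition packed_semigroups (m e : nat) : set (set nat) :=
  [set S | semigroups m e S /\ packed S].

Definition min_genus (m e : nat) : nat := min_of (genus @` semigroups m e).

Lemma submonoid_generated (A : set nat) : submonoid (generated A).
Proof.
split=> [M [[M0 _] _]//|x y Ax Ay M [Mm AM]].
by apply: (Mm.2); [apply: Ax|apply: Ay].
Qed.

Definition irreducibles (S : set nat) : set nat :=
  [set x | [/\ S x, 0 < x &
    forall y z, S y -> S z -> 0 < y -> 0 < z -> x <> y + z]].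

Lemma generated_irreducibles (S : set nat) :
  submonoid S -> generated (irreducibles S) = S.
Proof.
move=> Sm; apply/seteqP; split.
  by apply: smallest_sub => // x [].
have [G0 GD] := submonoid_generated (irreducibles S).
move=> x; have [n] := ubnP x; elim: n x => // n IHn x xn Sx.
have [->//|x0] := posnP x.
have [Ix|nIx] := pselect (irreducibles S x); first exact: sub_gen_smallest.
have [y [z [Sy Sz y0 z0 xyz]]] :
    exists y z, [/\ S y, S z, 0 < y, 0 < z & x = y + z].
  apply: contra_notP nIx => nyz; split=> // y z Sy Sz y0 z0 xyz.
  by apply: nyz; exists y, z.
rewrite xyz ltnS in xn *; apply: GD; apply: IHn => //.
  by apply: (leq_trans _ xn); rewrite -addn1 leq_add2l.
by apply: (leq_trans _ xn); rewrite -add1n leq_add2r.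
Qed.

Lemma irreducibles_sub (S B : set nat) :
  generated B = S -> irreducibles S `<=` B.
Proof.
move=> BS x [Sx x0 xirr]; apply: contrapT => nBx.
have [S0 SD] : submonoid S by rewrite -BS; exact: submonoid_generated.
have : generated B `<=` [set y | S y /\ y <> x].
  apply: smallest_sub => [|y By]; last first.
    split; first by rewrite -BS; exact: sub_gen_smallest.
    by move=> yx; apply: nBx; rewrite -yx.
  split=> [|y z [Sy yx] [Sz zx]]; first by split=> // x0'; rewrite -x0' in x0.
  split; first exact: SD.
  have [y0|y0] := posnP y; first by rewrite y0.
  have [z0|z0] := posnP z; first by rewrite z0 addn0.
  by move=> /esym; exact: xirr.
by rewrite BS => /(_ _ Sx) [].
Qed.

Lemma msg_unique (S A : set nat) :
  minimal_generators S A -> A = irreducibles S.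
Proof.
move=> [AS Amin]; have IA := irreducibles_sub AS.
apply: contrapT => AI; apply: (Amin (irreducibles S)).
  by split=> // AI'; apply: AI; apply/seteqP.
by apply: generated_irreducibles; rewrite -AS; exact: submonoid_generated.
Qed.

Lemma minimal_generators_msg (S : set nat) :
  submonoid S -> minimal_generators S (msg S).
Proof.
move=> Sm; apply: (@xgetPex _ _ (minimal_generators S)).
exists (irreducibles S); split; first exact: generated_irreducibles.
by move=> B [_ nIB] /irreducibles_sub.
Qed.

Lemma msgE (S : set nat) : submonoid S -> msg S = irreducibles S.
Proof. by move=> /minimal_generators_msg/msg_unique. Qed.

Lemma multiplicityP (S : set nat) : numerical_semigroup S ->
  is_min [set n | S n /\ 0 < n] (multiplicity S).
Proof.
move=> [_ fS]; apply: min_ofP; apply: contrapT => S0.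
apply: infinite_nat; have : [set: nat] `<=` 0 |` ~` S.
  move=> [|n] _; [by left|right=> Sn; apply: S0].
  by exists n.+1.
by move/sub_finite_set; apply; rewrite finite_setU.
Qed.

Lemma finite_msg (S : set nat) : numerical_semigroup S -> finite_set (msg S).
Proof.
move=> Sn; have [Sm fS] := Sn; rewrite msgE//.
have [[Smu mu0] _] := multiplicityP Sn; set m := multiplicity S in Smu mu0.
apply: (@sub_finite_set _ _ (`I_m.+1 `|` (addn m) @` (~` S))).
  move=> x [Sx x0 xirr]; have [xm|mx] := leqP x m; [by left|right].
  exists (x - m); last by rewrite subnKC// ltnW.
  by move=> Sxm; apply: (xirr _ _ Smu Sxm) => //; rewrite ?subn_gt0 ?subnKC// ltnW.
by rewrite finite_setU; split; [exact: finite_II|exact: finite_image].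
Qed.

(* Main.v *)
Require Import Defs.
From mathcomp Require Import all_boot all_order finmap.
From mathcomp Require Import boolp classical_sets functions cardinality.

(** Packing a numerical semigroup [S] of multiplicity [m] means replacing each
    minimal generator [x] by the representative [m + x %% m] of its residue
    class in the interval from [m] to [2 * m - 1].  As [x] is obtained from its
    representative by adding a multiple of [m], the semigroup generated by the
    representatives contains [S] ([sub_packing]), so its genus is at most that
    of [S], with equality only if nothing changed ([genus_sub_eq]).

    The packed semigroup has the same multiplicity and embedding dimension.
    Two minimal generators of [S] cannot be congruent modulo [m], since the
    larger would be the smaller plus a multiple of [m]; hence there are as many
    representatives as generators ([msg_modn_inj]).  And any set containing
    [m] and contained in that interval is automatically a minimal system of
    generators, because a sum of two nonzero elements of the semigroup is at
    least [2 * m] ([msg_generated]).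

    A semigroup of least genus is therefore equal to its packing, hence packed,
    which gives both claims once some semigroup with the given multiplicity and
    embedding dimension is known to exist: the one generated by
    [m, m + 1, ..., m + e - 1] is such ([semigroups_nonempty]). *)

Local Open Scope classical_set_scope.

Lemma submonoid_mul {S : set nat} {k x : nat} :
  submonoid S -> S x -> S (k * x).
Proof.
move=> [S0 SD] Sx; elim: k => [|k IHk]; first by rewrite mul0n.
by rewrite mulSn; apply: SD.
Qed.

(** Inclusion reverses genus strictly: equality of the cardinals of nested
    finite sets of gaps forces equality of the sets. *)
Lemma genus_sub_eq (S T : set nat) :
  finite_set (~` S) -> S `<=` T -> genus S <= genus T -> S = T.
Proof.
move=> fS ST gST.
have TS : ~` T `<=` ~` S by move=> x nTx Sx; apply: nTx; apply: ST.
have fT : finite_set (~` T) := sub_finite_set TS fS.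
have sub : (fset_set (~` T) `<=` fset_set (~` S))%fset.
  by rewrite -fset_set_sub.
have eqTS : fset_set (~` T) = fset_set (~` S).
  by apply/eqP; rewrite eqEfcard sub.
by apply: setC_inj; apply/esym/fset_set_inj.
Qed.

Lemma card_of_image (f : nat -> nat) (A : set nat) :
  finite_set A -> {in A &, injective f} -> card_of (f @` A) = card_of A.
Proof.
move=> fA finj; rewrite /card_of fset_set_image// card_in_imfset//=.
by move=> x y; rewrite !in_fset_set//; exact: finj.
Qed.

Lemma generated_ge {m : nat} {A : set nat} {x : nat} :
  A `<=` [set x | m <= x] -> generated A x -> 0 < x -> m <= x.
Proof.
move=> Am Ax; suff sub : generated A `<=` [set x | x = 0 \/ m <= x].
  by have [->|//] := sub _ Ax.
apply: smallest_sub => [|y /Am]; last by right.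
split=> [|y z]; first by left.
move=> [->|my] [->|mz]; rewrite ?addn0; [by left|by right|by right|right].
exact: leq_trans my (leq_addr _ _).
Qed.

Section GeneratedByInterval.
Context {m : nat} {A : set nat}.
Hypotheses (m0 : 0 < m) (Am : A m).
Hypothesis A_itv : A `<=` [set x | m <= x <= 2 * m - 1].

Let A_ge : A `<=` [set x | m <= x].
Proof. by move=> x /A_itv /andP[]. Qed.

Lemma msg_generated : msg (generated A) = A.
Proof.
rewrite msgE; last exact: submonoid_generated.
apply/seteqP; split; first exact: irreducibles_sub.
move=> x Ax; have /andP[mx x2m] := A_itv _ Ax; split.
- exact: sub_gen_smallest.
- exact: leq_trans m0 mx.
move=> y z Gy Gz y0 z0 xyz.
have my := generated_ge A_ge Gy y0; have mz := generated_ge A_ge Gz z0.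
have := leq_add my mz; rewrite -xyz addnn -mul2n leqNgt => /negP; apply.
by rewrite (leq_ltn_trans x2m)// ltn_subrL muln_gt0.
Qed.

Lemma multiplicity_generated :
  finite_set (~` generated A) -> multiplicity (generated A) = m.
Proof.
move=> fG; apply: (is_min_inj (multiplicityP _)).
  by split=> //; exact: submonoid_generated.
split; first by split=> //; exact: sub_gen_smallest.
by move=> k [Gk k0]; exact: generated_ge A_ge Gk k0.
Qed.

Lemma packed_semigroups_generated :
  finite_set (~` generated A) -> packed_semigroups m (card_of A) (generated A).
Proof.
move=> fG; have mG := multiplicity_generated fG; split.
  split=> //; last by rewrite /embedding_dim msg_generated.
  by split=> //; exact: submonoid_generated.
by rewrite /packed msg_generated mG.
Qed.

End GeneratedByInterval.

Definition packing (S : set nat) : set nat :=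
  generated ((fun x => multiplicity S + x %% multiplicity S) @` msg S).

Section Packing.
Context {S : set nat}.
Hypothesis S_num : numerical_semigroup S.
Let m := multiplicity S.

Let S_sub : submonoid S := S_num.1.

Let Sm : S m. Proof. by have [[]] := multiplicityP S_num. Qed.

Let m0 : 0 < m. Proof. by have [[]] := multiplicityP S_num. Qed.

Let m_min x : S x -> 0 < x -> m <= x.
Proof. by move=> Sx x0; have [_] := multiplicityP S_num; apply. Qed.

Lemma msg_multiplicity : msg S m.
Proof.
rewrite msgE//; split=> // y z Sy Sz y0 z0 myz.
have := m_min _ Sy y0.
by rewrite myz leqNgt -[X in X < _]addn0 ltn_add2l z0.
Qed.

Lemma msg_modn_inj : {in msg S &, injective (fun x => m + x %% m)}.
Proof.
suff le x y : msg S x -> msg S y -> x %% m = y %% m -> y <= x.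
  move=> x y /set_mem Sx /set_mem Sy /addnI xy.
  by apply/eqP; rewrite eqn_leq !le.
rewrite msgE// => -[Sx x0 _] [Sy y0 yirr] xy; rewrite leqNgt; apply/negP => ltxy.
have dvd : m %| y - x by rewrite -eqn_mod_dvd ?(ltnW ltxy)// xy.
have Syx : S (y - x) by rewrite -(divnK dvd); exact: submonoid_mul.
apply: (yirr _ _ Sx Syx) => //; first by rewrite subn_gt0.
by rewrite subnKC// ltnW.
Qed.

Lemma sub_packing : S `<=` packing S.
Proof.
have Gsub : submonoid (packing S) := submonoid_generated _.
rewrite -{1}(generated_irreducibles S_sub) -msgE//.
apply: smallest_sub => // x Mx.
have mx : m <= x by move: Mx; rewrite msgE// => -[Sx x0 _]; exact: m_min.
have Gm : packing S m.
  apply: sub_gen_smallest; exists m; first exact: msg_multiplicity.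
  by rewrite modnn addn0.
have Gx : packing S (m + x %% m) by apply: sub_gen_smallest; exists x.
(* One copy of [m] is already in the representative, hence [x %/ m - 1]. *)
have -> : x = (m + x %% m) + (x %/ m - 1) * m.
  rewrite mulnBl mul1n addnAC subnKC; first by rewrite -divn_eq.
  by rewrite -[X in X <= _]mul1n leq_mul2r divn_gt0// mx orbT.
exact: Gsub.2 _ _ Gx (submonoid_mul Gsub Gm).
Qed.

Lemma packing_packed : packed_semigroups m (embedding_dim S) (packing S).
Proof.
rewrite /embedding_dim -(card_of_image (fun x => m + x %% m)); last first.
- exact: msg_modn_inj.
- exact: finite_msg.
apply: packed_semigroups_generated => //.
- by exists m; [exact: msg_multiplicity | rewrite modnn addn0].
- move=> _ [x _ <-] /=; rewrite leq_addr/= mul2n -addnn -addnBA// leq_add2l.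
  by rewrite subn1 -ltnS prednK// ltn_pmod.
- by apply: sub_finite_set S_num.2; apply: subsetC; exact: sub_packing.
Qed.

End Packing.

Lemma card_of_shifted_initial (m e : nat) : card_of (addn m @` `I_e) = e.
Proof.
rewrite card_of_image; [|exact: finite_II|by move=> x y _ _ /addnI].
exact: card_fset_set (card_eqxx _).
Qed.

(** Every [n >= m * m] lies in the semigroup generated by [m] and [m.+1]: for
    [n = q * m + r] with [r < m <= q], one has
    [n = (q - r) * m + r * m.+1]. *)
Lemma finite_setC_submonoid {m : nat} {S : set nat} : 0 < m ->
  submonoid S -> S m -> S m.+1 -> finite_set (~` S).
Proof.
move=> m0 Ssub Sm Sm1; apply: (@sub_finite_set _ _ `I_(m * m)); last first.
  exact: finite_II.
move=> n nSn /=; rewrite ltnNge; apply/negP => mmn; apply: nSn.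
have rq : n %% m <= n %/ m.
  by rewrite ltnW// (leq_trans (ltn_pmod n m0))// leq_divRL.
have -> : n = (n %/ m - n %% m) * m + n %% m * m.+1.
  by rewrite mulnS addnCA -mulnDl subnK// addnC -divn_eq.
exact: Ssub.2 _ _ (submonoid_mul Ssub Sm) (submonoid_mul Ssub Sm1).
Qed.

Lemma semigroups_nonempty (m e : nat) :
  2 <= e -> e <= m -> semigroups m e !=set0.
Proof.
move=> e2 em; have m0 : 0 < m by rewrite (leq_trans _ em)// ltnW.
exists (generated (addn m @` `I_e)).
rewrite -{1}(card_of_shifted_initial m e).
have Am : (addn m @` `I_e) m by exists 0; rewrite /= ?addn0// ltnW.
apply: (proj1 (packed_semigroups_generated m0 Am _ _)).
  move=> _ [i /= ie <-]; rewrite leq_addr/= mul2n -addnn -addnBA// leq_add2l.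
  by rewrite subn1 -ltnS prednK// (leq_trans ie em).
apply: (finite_setC_submonoid m0); first exact: submonoid_generated.
  exact: sub_gen_smallest.
by apply: sub_gen_smallest; exists 1; rewrite /= ?addn1.
Qed.

(** The packing of [S] contains [S] and belongs to the same family, so
    minimality of the genus of [S] forces the two to coincide. *)
Lemma min_genus_packed (m e : nat) (S : set nat) :
  semigroups m e S ->
  (forall T, semigroups m e T -> genus S <= genus T) -> packed S.
Proof.
move=> [S_num <- <-] Smin; have [Tsg Tpacked] := packing_packed S_num.
rewrite (genus_sub_eq S (packing S))//; first exact: S_num.2.
- exact: sub_packing.
- exact: Smin.
Qed.

Theorem corollary15 (m e : nat) (he : 2 <= e) (hm : e <= m) :
  is_min (genus @` packed_semigroups m e) (min_genus m e) /\
  [set S | semigroups m e S /\ genus S = min_genus m e] =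
  [set S | packed_semigroups m e S /\ genus S = min_genus m e].
Proof.
have [[S Ssg gS] gmin] : is_min (genus @` semigroups m e) (min_genus m e).
  apply: min_ofP; have [S Ssg] := semigroups_nonempty m e he hm.
  by exists (genus S), S.
have min_packed T : semigroups m e T -> genus T = min_genus m e -> packed T.
  move=> Tsg gT; apply: (min_genus_packed m e) => // U Usg.
  by rewrite gT; apply: gmin; exists U.
split.
  split; first by exists S => //; split=> //; exact: min_packed.
  by move=> _ [T [Tsg _] <-]; apply: gmin; exists T.
apply/seteqP; split=> T [].
  by move=> Tsg gT; do 2!split=> //; exact: min_packed.
by move=> [Tsg _] gT.
Qed.
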